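(* Consider the consistent linear system $Ax=b$, where the coefficient matrix $A\in\mathbb{R}^{m\times n}$ and $b\in\mathbb{R}^m$. Let $x^{(0)}\in\mathbb{R}^n$ be an arbitrary initial approximation, and let $\tilde{x}$ be a solution of $Ax=b$ such that $P_{N(A)}(\tilde{x})=P_{N(A)}(x^{(0)})$. Then the iteration sequence $\{x^{(k)}\}_{k=1}^{\infty}$ generated by the GRKO method obeys $$E\|x^{(k)}-\tilde{x}\|^2\leq \prod_{s=0}^{k-1}\zeta_s\,\|x^{(0)}-\tilde{x}\|^2,$$ where $$\zeta_0=1-\frac{\lambda_{\min}(A^TA)}{m\|A\|_F^2},\qquad \zeta_1=1-\frac12\left(\frac{1}{\gamma_1}\|A\|_F^2+1\right)\frac{\lambda_{\min}(A^TA)}{\Delta\cdot\|A\|_F^2},$$ $$\zeta_k=1-\frac12\left(\frac{1}{\gamma_2}\|A\|_F^2+1\right)\frac{\lambda_{\min}(A^TA)}{\Delta\cdot\|A\|_F^2}\quad(\forall k>1),$$ with $$\gamma_1=\max_{1\le i\le m}\sum_{\substack{s=1\\ s\ne i}}^m\|a_s\|^2,\qquad \gamma_2=\max_{\substack{1\le i,j\le m\\ i\ne j}}\sum_{\substack{s=1\\ s\ne i,j}}^m\|a_s\|^2,\qquad \Delta=\max_{j\neq k}\sin^2\langle a_j,a_k\rangle\ (\in(0,1]),$$ where in the definition of $\Delta$ the symbol $\langle a_j,a_k\rangle$ denotes the angle between $a_j$ and $a_k$. In addition, if $x^{(0)}\in R(A^T)$, the sequence $\{x^{(k)}\}_{k=1}^{\infty}$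 converges to the least-norm solution of $Ax=b$, i.e. $\lim_{k\to\infty}x^{(k)}=x^*=A^\dagger b$.
   Context: Notation: $a_i^T$ is the $i$th row of $A$ (so $a_i\in\mathbb{R}^n$), $b_i$ the $i$th entry of $b$; $\|\cdot\|$ is the Euclidean norm, $\|\cdot\|_F$ the Frobenius norm; $\langle\cdot,\cdot\rangle$ is the scalar product (except in the definition of $\Delta$, where it denotes an angle, so that $\sin^2\langle a_j,a_k\rangle = 1-\frac{(a_j^Ta_k)^2}{\|a_j\|^2\|a_k\|^2}$); $R(\cdot)$ and $N(\cdot)$ are the range space and null space; $P_C(x)$ is the orthogonal projection of $x$ onto $C$; $A^\dagger$ is the Moore-Penrose pseudoinverse; $\lambda_{\min}(G)$ is the smallest nonzero eigenvalue of $G$; $E$ is the full expectation over the random index choices. GRKO method (greedy randomized Kaczmarz method with oblique projection): given $A$, $b$, $x^{(0)}$, set $M(i)=\|a_i\|^2$ for $i=1,\dots,m$. Initial step: randomly select $i_1\in\{1,\dots,m\}$ (each index with probability $1/m$) and compute $x^{(1)}=x^{(0)}+\frac{b_{i_1}-\langle a_{i_1},x^{(0)}\rangle}{M(i_1)}a_{i_1}$. For $k=1,2,\dots$ (in practice up to a prescribed number of steps): (1) Compute $\varepsilon_k=\frac12\left(\frac{1}{\|b-Ax^{(k)}\|^2}\max_{1\le i\le m}\frac{|b_i-\langle a_i,x^{(k)}\rangle|^2}{\|a_i\|^2}+\frac{1}{\|A\|_F^2}\right)$. (2) Determine the index set $\mathcal{U}_k=\{i : |b_i-\langle a_i,x^{(k)}\rangle|^2\ge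 \varepsilon_k\|b-Ax^{(k)}\|^2\|a_i\|^2\}$. (3) Let $\tilde r^{(k)}\in\mathbb{R}^m$ have entries $\tilde r_i^{(k)}=b_i-\langle a_i,x^{(k)}\rangle$ if $i\in\mathcal{U}_k$ and $\tilde r_i^{(k)}=0$ otherwise. (4) Select $i_{k+1}\in\mathcal{U}_k$, index $i$ being selected with probability $|\tilde r_i^{(k)}|^2/\|\tilde r^{(k)}\|^2$. (5) Compute $D_{i_k}=\langle a_{i_k},a_{i_{k+1}}\rangle$, $w^{(i_k)}=a_{i_{k+1}}-\frac{D_{i_k}}{M(i_k)}a_{i_k}$ and $h_{i_k}=\|w^{(i_k)}\|^2=M(i_{k+1})-\frac{D_{i_k}}{M(i_k)}D_{i_k}$. (6) Set $\alpha_{i_k}^{(k)}=\tilde r_{i_{k+1}}^{(k)}/h_{i_k}$ and $x^{(k+1)}=x^{(k)}+\alpha_{i_k}^{(k)}w^{(i_k)}$.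
   Formalization: All rows of A are assumed nonzero; Δ>0 is claimed only for rank A>1 (else Δ=0); if rank A=2 and k>2 the bound assumes ζ_2≥0 (the method has already stopped; three unit rows at 120° in the plane give ζ_2=-1/3 and a negative bound at k=3). *)

(* Defs.v *)
From HB Require Import structures.
From mathcomp Require Import all_boot all_order all_algebra.
From mathcomp Require Import all_classical all_reals all_analysis.

Set Implicit Arguments.
Unset Strict Implicit.
Unset Printing Implicit Defensive.

Import Order.TTheory GRing.Theory Num.Theory.
Import numFieldNormedType.Exports.

Local Open Scope classical_set_scope.
Local Open Scope ring_scope.

Section Euclidean.
Context {R : realType}.

Definition dotv n (u v : 'cV[R]_n) : R := \sum_(i < n) u i 0 * v i 0.

(* The library norm on matrices is the sup norm, hence this one. *)
Definition norm2 n (u : 'cV[R]_n) : R := Num.sqrt (dotv u u).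

Definition normF m n (A : 'M[R]_(m, n)) : R :=
  Num.sqrt (\sum_(i < m) \sum_(j < n) A i j ^+ 2).

Definition rowv m n (A : 'M[R]_(m, n)) (i : 'I_m) : 'cV[R]_n := (row i A)^T.

Definition range_space m n (A : 'M[R]_(m, n)) : set 'cV[R]_m :=
  range (mulmx A : 'cV[R]_n -> 'cV[R]_m).

Definition null_space m n (A : 'M[R]_(m, n)) : set 'cV[R]_n :=
  [set x | A *m x = 0].

(* Orthogonal projection onto a linear subspace C. *)
Definition orth_proj n (C : set 'cV[R]_n) (x : 'cV[R]_n) : 'cV[R]_n :=
  xget 0 [set p | C p /\ forall y, C y -> dotv (x - p) y = 0].

(* The four Penrose equations. *)
Definition is_mp_inverse m n (A : 'M[R]_(m, n)) (X : 'M[R]_(n, m)) : Prop :=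
  [/\ A *m X *m A = A, X *m A *m X = X,
      (A *m X)^T = A *m X & (X *m A)^T = X *m A].

Definition mp_inverse m n (A : 'M[R]_(m, n)) : 'M[R]_(n, m) := xget 0 (is_mp_inverse A).

(* Smallest nonzero eigenvalue; the set is finite, so that its infimum is a
   minimum as soon as it is nonempty. *)
Definition lambda_min n (G : 'M[R]_n) : R :=
  inf [set l : R | l != 0 /\ eigenvalue G l].

Definition is_least_norm_solution m n (A : 'M[R]_(m, n)) (b : 'cV[R]_m)
    (x : 'cV[R]_n) : Prop :=
  A *m x = b /\ forall y, A *m y = b -> norm2 x <= norm2 y.

End Euclidean.

Section GRKO.
Context {R : realType} (m n : nat) (A : 'M[R]_(m, n)) (b : 'cV[R]_m).

Local Notation a := (rowv A).

Definition grko_M (i : 'I_m) : R := norm2 (a i) ^+ 2.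

(* In this section the maxima are over nonnegative families, so the default
   value 0 is only met when the index set is empty. *)
Definition grko_eps (x : 'cV[R]_n) : R :=
  2^-1 * ((norm2 (b - A *m x) ^+ 2)^-1
            * \big[Num.max/0]_(i < m)
                (`|b i 0 - dotv (a i) x| ^+ 2 / norm2 (a i) ^+ 2)
          + (normF A ^+ 2)^-1).

Definition grko_U (x : 'cV[R]_n) : {set 'I_m} :=
  [set i : 'I_m | `|b i 0 - dotv (a i) x| ^+ 2
         >= grko_eps x * norm2 (b - A *m x) ^+ 2 * norm2 (a i) ^+ 2]%SET.

Definition grko_res (x : 'cV[R]_n) : 'cV[R]_m :=
  \col_(i < m) (if i \in grko_U x then b i 0 - dotv (a i) x else 0).

Definition grko_prob (x : 'cV[R]_n) (i : 'I_m) : R :=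
  `|grko_res x i 0| ^+ 2 / norm2 (grko_res x) ^+ 2.

Definition grko_first (x : 'cV[R]_n) (i : 'I_m) : 'cV[R]_n :=
  x + ((b i 0 - dotv (a i) x) / grko_M i) *: a i.

(* The step from x when i is the previous index and j the new one.  If
   A x = b then grko_res x = 0 and the step leaves x unchanged, whatever j:
   the method has terminated. *)
Definition grko_step (x : 'cV[R]_n) (i j : 'I_m) : 'cV[R]_n :=
  let w := a j - (dotv (a i) (a j) / grko_M i) *: a i in
  x + (grko_res x j 0 / norm2 w ^+ 2) *: w.

(* The k-th iterate for a given sequence of selected indices, numbered from 0:
   s k is the index used to compute the iterate number k + 1. *)
Fixpoint grko (x0 : 'cV[R]_n) (s : nat -> 'I_m) (k : nat) : 'cV[R]_n :=
  match k with
  | 0%N => x0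
  | k1.+1 =>
    match k1 with
    | 0%N => grko_first (grko x0 s k1) (s k1)
    | k2.+1 => grko_step (grko x0 s k1) (s k2) (s k1)
    end
  end.

(* The random indices follow the selection rule of the method: the first one
   is uniform; conditionally on idx 0 = s 0, ..., idx k = s k, the next one has
   law grko_prob at the current iterate.  Nothing is required of the selection
   once the residual vanishes (grko_prob would be 0 / 0), when the iterates no
   longer move. *)
Definition grko_selection (x0 : 'cV[R]_n) d (T : measurableType d)
    (P : probability T R) (idx : nat -> T -> 'I_m) : Prop :=
  [/\ forall k i, measurable [set t | idx k t = i],
      forall i, P [set t | idx 0%N t = i] = (m%:R^-1)%:E
    & forall (k : nat) (s : nat -> 'I_m) (j : 'I_m),
        A *m grko x0 s k.+1 <> b ->
        let past := [set t | forall l, (l <= k)%N -> idx l t = s l] in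
        P (past `&` [set t | idx k.+1 t = j])
        = (P past * (grko_prob (grko x0 s k.+1) j)%:E)%E].

Definition grko_gamma1 : R :=
  \big[Num.max/0]_(i < m) \sum_(s < m | s != i) norm2 (a s) ^+ 2.

Definition grko_gamma2 : R :=
  \big[Num.max/0]_(i < m) \big[Num.max/0]_(j < m | i != j)
    \sum_(s < m | (s != i) && (s != j)) norm2 (a s) ^+ 2.

Definition sin2_angle (u v : 'cV[R]_n) : R :=
  1 - dotv u v ^+ 2 / (norm2 u ^+ 2 * norm2 v ^+ 2).

Definition grko_Delta : R :=
  \big[Num.max/0]_(j < m) \big[Num.max/0]_(k < m | j != k)
    sin2_angle (a j) (a k).

Definition grko_zeta (k : nat) : R :=
  match k with
  | 0%N => 1 - lambda_min (A^T *m A) / (m%:R * normF A ^+ 2)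
  | 1%N => 1 - 2^-1 * (grko_gamma1^-1 * normF A ^+ 2 + 1)
                 * (lambda_min (A^T *m A) / (grko_Delta * normF A ^+ 2))
  | _ => 1 - 2^-1 * (grko_gamma2^-1 * normF A ^+ 2 + 1)
               * (lambda_min (A^T *m A) / (grko_Delta * normF A ^+ 2))
  end.

End GRKO.

(* Main.v *)
Require Import Defs.
From HB Require Import structures.
From mathcomp Require Import all_boot all_order all_algebra.
From mathcomp Require Import all_classical all_reals all_analysis.
From mathcomp Require Import measurable_realfun ring lra zify.

(* The oblique step from x with indices i, j moves along the part w of a_j
   orthogonal to a_i. If the error e = x - xt is orthogonal to a_i, then the new
   squared error is |e|^2 - r_j^2 / |w|^2, where |w|^2 = |a_j|^2 sin^2(a_i, a_j)
   <= Delta |a_j|^2, and the new error is orthogonal to both a_i and a_j. For j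
   in U_k we have r_j^2 >= eps_k |r|^2 |a_j|^2; since the residual vanishes at
   the last one (k = 1) or two (k > 1) indices, eps_k |r|^2 >=
   (1/gamma + 1/|A|_F^2) |r|^2 / 2, and |r|^2 = |A e|^2 >= lambda_min |e|^2
   because e stays in the row space of A. Averaging over the selection gives the
   factors zeta_k. For k > 1 these are a constant < 1 when Delta > 0, so the
   expected squared errors are summable, whence almost sure convergence; if
   Delta = 0, all rows are parallel and the first step solves the system. *)

Set Implicit Arguments.
Unset Strict Implicit.
Unset Printing Implicit Defensive.

Import Order.TTheory GRing.Theory Num.Theory.
Import numFieldNormedType.Exports.

Local Open Scope classical_set_scope.
Local Open Scope ring_scope.

(** * Scalar product, Frobenius norm and the pseudoinverse *)

Section Dotv.
Context {R : realType}.
Implicit Types (m n : nat).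

Lemma dotvE n (u v : 'cV[R]_n) : dotv u v = (u^T *m v) 0 0.
Proof. by rewrite mxE; apply: eq_bigr => i _; rewrite mxE. Qed.

Lemma dotvC n (u v : 'cV[R]_n) : dotv u v = dotv v u.
Proof. by apply: eq_bigr => i _; rewrite mulrC. Qed.

Lemma dotvDr n (u v w : 'cV[R]_n) : dotv u (v + w) = dotv u v + dotv u w.
Proof. by rewrite !dotvE mulmxDr mxE. Qed.

Lemma dotvZr n (u v : 'cV[R]_n) c : dotv u (c *: v) = c * dotv u v.
Proof. by rewrite !dotvE -scalemxAr mxE. Qed.

Lemma dotvNr n (u v : 'cV[R]_n) : dotv u (- v) = - dotv u v.
Proof. by rewrite -scaleN1r dotvZr mulN1r. Qed.

Lemma dotvBr n (u v w : 'cV[R]_n) : dotv u (v - w) = dotv u v - dotv u w.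
Proof. by rewrite dotvDr dotvNr. Qed.

Lemma dotvDl n (u v w : 'cV[R]_n) : dotv (u + v) w = dotv u w + dotv v w.
Proof. by rewrite dotvC dotvDr !(dotvC w). Qed.

Lemma dotvZl n (u v : 'cV[R]_n) c : dotv (c *: u) v = c * dotv u v.
Proof. by rewrite dotvC dotvZr dotvC. Qed.

Lemma dotvNl n (u v : 'cV[R]_n) : dotv (- u) v = - dotv u v.
Proof. by rewrite dotvC dotvNr dotvC. Qed.

Lemma dotvBl n (u v w : 'cV[R]_n) : dotv (u - v) w = dotv u w - dotv v w.
Proof. by rewrite dotvDl dotvNl. Qed.

Lemma dotv0l n (u : 'cV[R]_n) : dotv 0 u = 0.
Proof. by rewrite dotvE trmx0 mul0mx mxE. Qed.

Lemma dotv0r n (u : 'cV[R]_n) : dotv u 0 = 0.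
Proof. by rewrite dotvC dotv0l. Qed.

Lemma dotv_ge0 n (u : 'cV[R]_n) : 0 <= dotv u u.
Proof. by apply: sumr_ge0 => i _; rewrite -expr2 sqr_ge0. Qed.

Lemma dotv_eq0 n (u : 'cV[R]_n) : (dotv u u == 0) = (u == 0).
Proof.
apply/eqP/eqP => [|->]; last by rewrite dotv0l.
move/eqP; rewrite psumr_eq0 => [/allP u0|i _]; last by rewrite -expr2 sqr_ge0.
apply/matrixP => i j; rewrite (ord1 j) mxE.
by have := u0 i; rewrite mem_index_enum -expr2 sqrf_eq0 => /(_ isT)/eqP.
Qed.

Lemma dotv_gt0 n (u : 'cV[R]_n) : (0 < dotv u u) = (u != 0).
Proof. by rewrite lt_def dotv_ge0 andbT dotv_eq0. Qed.

Lemma norm2_sqr n (u : 'cV[R]_n) : norm2 u ^+ 2 = dotv u u.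
Proof. by rewrite sqr_sqrtr // dotv_ge0. Qed.

Lemma dotv_mull m n (M : 'M[R]_(m, n)) u v : dotv (M *m u) v = dotv u (M^T *m v).
Proof. by rewrite !dotvE trmx_mul mulmxA. Qed.

Lemma dotv_rowv m n (M : 'M[R]_(m, n)) i u : dotv (rowv M i) u = (M *m u) i 0.
Proof. by rewrite mxE; apply: eq_bigr => j _; rewrite !mxE. Qed.

Lemma normF_sqr m n (M : 'M[R]_(m, n)) :
  normF M ^+ 2 = \sum_i norm2 (rowv M i) ^+ 2.
Proof.
rewrite sqr_sqrtr; last first.
  by apply: sumr_ge0 => i _; apply: sumr_ge0 => j _; rewrite sqr_ge0.
apply: eq_bigr => i _; rewrite norm2_sqr; apply: eq_bigr => j _.
by rewrite !mxE expr2.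
Qed.

Lemma dotv_CS n (u v : 'cV[R]_n) : dotv u v ^+ 2 <= dotv u u * dotv v v.
Proof.
have [->|v0] := eqVneq v 0; first by rewrite !dotv0r expr0n mulr0.
have vv : 0 < dotv v v by rewrite dotv_gt0.
have := dotv_ge0 (u - (dotv u v / dotv v v) *: v).
rewrite dotvBl !dotvBr !dotvZl !dotvZr (dotvC v u) => h.
rewrite -subr_ge0 -(pmulr_rge0 _ vv).
suff -> : dotv v v * (dotv u u * dotv v v - dotv u v ^+ 2) =
   dotv v v ^+ 2 * (dotv u u - dotv u v / dotv v v * dotv u v -
      (dotv u v / dotv v v * dotv u v -
       dotv u v / dotv v v * (dotv u v / dotv v v * dotv v v))).
  apply: mulr_ge0; first exact: sqr_ge0. exact: h.
field; exact: lt0r_neq0.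
Qed.

Lemma mulmx_dotv_le m n (M : 'M[R]_(m, n)) (u : 'cV[R]_n) :
  dotv (M *m u) (M *m u) <= normF M ^+ 2 * dotv u u.
Proof.
rewrite normF_sqr mulr_suml; apply: ler_sum => i _.
by rewrite -dotv_rowv -expr2 norm2_sqr dotv_CS.
Qed.

Lemma gram_unitmx m n (M : 'M[R]_(m, n)) : row_free M -> M *m M^T \in unitmx.
Proof.
move=> Mfree; rewrite -row_free_unit -kermx_eq0; apply/eqP/row_matrixP => i.
set v := row i _; have vk : v *m (M *m M^T) = 0.
  by rewrite -row_mul mulmx_ker row0.
suff /eqP : M^T *m v^T = 0.
  rewrite -trmx_mul trmx_eq0 => /eqP vM0.
  by rewrite row0; apply: (row_free_inj Mfree); rewrite mul0mx.
apply/eqP; rewrite -dotv_eq0 dotv_mull trmxK.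
suff -> : M *m (M^T *m v^T) = 0 by rewrite dotv0r.
by apply: trmx_inj; rewrite !trmx_mul !trmxK -mulmxA vk trmx0.
Qed.

(** From a full rank factorization A = C B, the witness is B^T (B B^T)^-1 (C^T C)^-1 C^T, where both
    Gram matrices are invertible. *)
Lemma mp_inverse_exists m n (A : 'M[R]_(m, n)) : exists X, is_mp_inverse A X.
Proof.
have [r [C [B [Cfull Bfree CBA]]]] :
    exists (r : nat) (C : 'M[R]_(m, r)) (B : 'M[R]_(r, n)),
    [/\ row_full C, row_free B & C *m B = A].
  exists (\rank A), (col_base A), (row_base A).
  by rewrite col_base_full row_base_free mulmx_base.
have Bu : B *m B^T \in unitmx by apply: gram_unitmx.
have Cu : C^T *m C \in unitmx.
  by rewrite -{2}[C]trmxK; apply: gram_unitmx; rewrite /row_free mxrank_tr.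
pose X := B^T *m invmx (B *m B^T) *m invmx (C^T *m C) *m C^T.
have AX : A *m X = C *m invmx (C^T *m C) *m C^T.
  by rewrite -CBA /X !mulmxA -(mulmxA C B) mulmxK.
have XA : X *m A = B^T *m invmx (B *m B^T) *m B.
  rewrite -CBA /X !mulmxA -(mulmxA _ C^T C) -(mulmxA _ _ (C^T *m C)).
  by rewrite mulVmx // mulmx1.
exists X; split.
- by rewrite AX -CBA !mulmxA -(mulmxA _ C^T C) mulmxKV.
- by rewrite XA /X !mulmxA -(mulmxA _ B B^T) mulmxKV.
- rewrite AX !trmx_mul trmxK trmx_inv trmx_mul trmxK; by rewrite mulmxA.
- rewrite XA !trmx_mul trmxK trmx_inv trmx_mul trmxK; by rewrite mulmxA.
Qed.

Lemma mp_inverseP m n (A : 'M[R]_(m, n)) : is_mp_inverse A (mp_inverse A).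
Proof. by rewrite /mp_inverse; case: (mp_inverse_exists A) => X; apply: xgetI. Qed.

End Dotv.

(** * Row space of A and the smallest nonzero eigenvalue of A^T A *)

Section RowSpace.
Context {R : realType} (m n : nat) (A : 'M[R]_(m, n)).

Local Notation rs := (range_space A^T).

(** The pseudoinverse times A is the orthogonal projector onto the row space, so its fixed points
    are that space. *)
Lemma range_trP (e : 'cV[R]_n) : rs e <-> mp_inverse A *m (A *m e) = e.
Proof.
have [AXA _ _ XAs] := mp_inverseP A; split=> [[y _ <-]|<-].
  by rewrite !mulmxA -XAs -trmx_mul mulmxA AXA.
by exists ((mp_inverse A)^T *m e) => //; rewrite mulmxA -trmx_mul XAs mulmxA.
Qed.

Lemma range_trD (u v : 'cV[R]_n) : rs u -> rs v -> rs (u + v).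
Proof. by move=> [x _ <-] [y _ <-]; exists (x + y); rewrite ?mulmxDr. Qed.

Lemma range_trZ c (u : 'cV[R]_n) : rs u -> rs (c *: u).
Proof. by move=> [x _ <-]; exists (c *: x); rewrite ?scalemxAr. Qed.

Lemma range_trB (u v : 'cV[R]_n) : rs u -> rs v -> rs (u - v).
Proof. by move=> hu hv; rewrite -scaleN1r; apply/range_trD/range_trZ. Qed.

Lemma rowv_range i : rs (rowv A i).
Proof.
exists (delta_mx i 0) => //.
by rewrite -[in delta_mx _ _]trmx_delta -trmx_mul -rowE.
Qed.

Lemma range_tr_orth (e : 'cV[R]_n) :
  (forall y, A *m y = 0 -> dotv e y = 0) -> rs e.
Proof.
have [AXA _ _ XAs] := mp_inverseP A; move=> eN; apply/range_trP.
set p := mp_inverse A *m _.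
have Np : A *m (e - p) = 0 by rewrite mulmxBr /p !mulmxA AXA subrr.
apply/esym/eqP; rewrite -subr_eq0 -dotv_eq0 dotvBl eN // sub0r oppr_eq0.
by rewrite {1}/p mulmxA -XAs dotv_mull trmxK -mulmxA Np mulmx0 dotv0r.
Qed.

(** A crude constant that keeps the Rayleigh quotient away from 0 before its infimum is known to be
    an eigenvalue. *)
Lemma range_tr_lower (e : 'cV[R]_n) : rs e ->
  dotv e e <= normF (mp_inverse A) ^+ 2 * dotv (A *m e) (A *m e).
Proof. by move=> /range_trP {1 2}<-; apply: mulmx_dotv_le. Qed.

Lemma range_tr_inj (e : 'cV[R]_n) : rs e -> A *m e = 0 -> e = 0.
Proof. by move=> /range_trP re Ae; rewrite -re Ae mulmx0. Qed.

(* mu is the minimum of the Rayleigh quotient of A^T A on the row space. If it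
   were not an eigenvalue, then B = A^T A - mu would be invertible; as
   <B u, u> >= 0 at the gradient step u = e - t B e, for t small <B e, e> would
   be at least a multiple of |B e|^2, hence of |e|^2, so mu could be increased. *)
Lemma lambda_min_gram : A != 0 ->
  0 < lambda_min (A^T *m A) /\
  forall e, rs e -> lambda_min (A^T *m A) * dotv e e <= dotv (A *m e) (A *m e).
Proof.
move=> A0; set G := A^T *m A.
have GE u v : dotv (A *m u) (A *m v) = dotv u (G *m v).
  by rewrite dotv_mull mulmxA.
have [e0 re0 e0_neq0] : exists2 e, rs e & e != 0.
  have [[i ri]|r0] := pselect (exists i, rowv A i != 0).
    by exists (rowv A i) => //; exact: rowv_range.
  case/eqP: A0; apply/row_matrixP => i; rewrite row0; apply: trmx_inj.
  by rewrite trmx0; apply/eqP/negPn/negP => ri; apply: r0; exists i.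
set K := normF (mp_inverse A) ^+ 2.
have K_gt0 : 0 < K.
  rewrite lt_def sqr_ge0 andbT; apply: contraNneq e0_neq0 => K0.
  by have := range_tr_lower re0; rewrite -/K K0 mul0r -dotv_eq0 eq_le dotv_ge0 andbT.
pose S := [set c : R | forall e, rs e -> c * dotv e e <= dotv (A *m e) (A *m e)].
have S_ub c : S c -> forall e, rs e -> e != 0 ->
    c <= dotv (A *m e) (A *m e) / dotv e e.
  by move=> Sc e re e_neq0; rewrite ler_pdivlMr ?dotv_gt0 //; apply: Sc.
have SK : S K^-1.
  by move=> e re; rewrite ler_pdivrMl //; apply: range_tr_lower.
have supS : has_sup S.
  split; first by exists K^-1.
  by exists (dotv (A *m e0) (A *m e0) / dotv e0 e0) => c /S_ub; apply.
pose mu := sup S.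
have mu_gt0 : 0 < mu.
  by apply: lt_le_trans (ub_le_sup _ SK); [rewrite invr_gt0|case: supS].
have Smu : S mu.
  move=> e re; have [->|e_neq0] := eqVneq e 0; first by rewrite mulmx0 !dotv0r mulr0.
  rewrite -ler_pdivlMr ?dotv_gt0 //; apply: ge_sup; first by case: supS.
  by move=> c Sc; apply: S_ub.
have Gmu : eigenvalue G mu.
  apply: contraT; rewrite /eigenvalue /eigenspace negbK kermx_eq0 row_free_unit.
  set B := G - mu%:M => Bu.
  pose Q u := dotv u (B *m u).
  have QE u : Q u = dotv (A *m u) (A *m u) - mu * dotv u u.
    by rewrite /Q mulmxBl mul_scalar_mx dotvBr dotvZr -GE.
  have Bs : B^T = B by rewrite linearB /= tr_scalar_mx trmx_mul trmxK.
  have rB u : rs u -> rs (B *m u).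
    move=> ru; rewrite mulmxBl mul_scalar_mx; apply: range_trB (range_trZ _ ru).
    by exists (A *m u); rewrite ?mulmxA.
  have Q_ge0 u : rs u -> 0 <= Q u by move=> ru; rewrite QE subr_ge0; apply: Smu.
  (* As Q v <= C |v|^2, the step length 1/C in u - B u / C controls the quadratic term and yields |B
     u|^2 <= C Q u. *)
  pose C := normF A ^+ 2 + 1.
  have C_gt0 : 0 < C by rewrite ltr_wpDl ?sqr_ge0.
  have Q_le u : Q u <= C * dotv u u.
    rewrite QE mulrDl; have := mulmx_dotv_le A u; have := dotv_ge0 u => u0.
    by have := mulr_ge0 (ltW mu_gt0) u0; lra.
  pose D := normF (invmx B) ^+ 2 + 1.
  have D_gt0 : 0 < D by rewrite ltr_wpDl ?sqr_ge0.
  have B_lower u : dotv u u <= D * dotv (B *m u) (B *m u).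
    have := mulmx_dotv_le (invmx B) (B *m u); rewrite mulmxA mulVmx // mul1mx.
    by move/le_trans; apply; rewrite ler_wpM2r ?dotv_ge0 // lerDl.
  have Q_lower u : rs u -> dotv (B *m u) (B *m u) <= C * Q u.
    move=> ru; set v := B *m u; have rv : rs v := rB _ ru.
    have := Q_ge0 _ (range_trB ru (range_trZ C^-1 rv)).
    have -> : Q (u - C^-1 *: v) = Q u - C^-1 * dotv v v *+ 2 + C^-1 ^+ 2 * Q v.
      have Bvu : dotv u (B *m v) = dotv v v by rewrite -{1}Bs -dotv_mull.
      rewrite /Q mulmxBr -scalemxAr -/v !dotvBl !dotvBr !dotvZl !dotvZr Bvu.
      ring.
    move=> h; rewrite -(ler_pM2l (_ : 0 < C^-1)) ?invr_gt0 //.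
    rewrite mulrA mulVf ?lt0r_neq0 // mul1r.
    have : C^-1 ^+ 2 * Q v <= C^-1 * dotv v v.
      rewrite expr2 -mulrA ler_pM2l ?invr_gt0 // ler_pdivrMl //; exact: Q_le.
    lra.
  pose del := (C * D)^-1.
  have del_gt0 : 0 < del by rewrite invr_gt0 mulr_gt0.
  have Sd : S (mu + del).
    move=> u ru; rewrite mulrDl -lerBrDl -QE ler_pdivrMl ?mulr_gt0 //.
    apply: le_trans (B_lower u) _; have -> : C * D * Q u = D * (C * Q u) by ring.
    by rewrite ler_pM2l //; exact: Q_lower.
  have : mu + del <= mu by apply: ub_le_sup => //; case: supS.
  by rewrite gerDl leNgt del_gt0.
(* An eigenvector for l <> 0 lies in the row space, so l >= 1/K. Thus the infimum is positive, and
   since mu is in the set it is at most mu. *)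
have eig_lb l : l != 0 -> eigenvalue G l -> K^-1 <= l.
  move=> l_neq0 /eigenvalueP[v vG v_neq0].
  have Gv : G *m v^T = l *: v^T.
    by apply: trmx_inj; rewrite trmx_mul trmxK linearZ /= trmxK trmx_mul trmxK vG.
  have rv : rs v^T.
    have -> : v^T = l^-1 *: (A^T *m (A *m v^T)).
      by rewrite mulmxA Gv scalerA mulVf // scale1r.
    by apply: range_trZ; exists (A *m v^T).
  have := SK _ rv; rewrite GE Gv dotvZr ler_pM2r // dotv_gt0.
  by rewrite trmx_eq0.
pose E := [set l | l != 0 /\ eigenvalue G l].
have Emu : E mu by split=> //; rewrite lt0r_neq0.
have Elb : lbound E K^-1 by move=> l [l0 lG]; apply: eig_lb.
split.
  apply: (@lt_le_trans _ _ K^-1); first by rewrite invr_gt0.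
  by apply: lb_le_inf => //; exists mu.
move=> e re; apply: le_trans (Smu _ re); rewrite ler_wpM2r ?dotv_ge0 //.
by apply: ge_inf; [exists K^-1|].
Qed.

End RowSpace.

(** * Oblique directions, angles between rows, and Delta *)

Section Angles.
Context {R : realType} (m n : nat) (A : 'M[R]_(m, n)).
Context (rows_neq0 : forall i, rowv A i != 0).
Local Notation a := (rowv A).
Local Notation rs := (range_space A^T).

Definition oblique_dir (i j : 'I_m) : 'cV[R]_n :=
  a j - (dotv (a i) (a j) / grko_M A i) *: a i.

Local Notation w := oblique_dir.

Lemma grko_M_gt0 i : 0 < grko_M A i.
Proof. by rewrite /grko_M norm2_sqr dotv_gt0. Qed.

Lemma grko_M_neq0 i : grko_M A i != 0.
Proof. exact/lt0r_neq0/grko_M_gt0. Qed.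

Lemma oblique_dir_orth i j : dotv (a i) (w i j) = 0.
Proof.
by rewrite dotvBr dotvZr -norm2_sqr -/(grko_M A i) divfK ?subrr // grko_M_neq0.
Qed.

Lemma oblique_dir_row i j : dotv (a j) (w i j) = dotv (w i j) (w i j).
Proof. by rewrite {2}/w dotvBl dotvZl oblique_dir_orth mulr0 subr0. Qed.

Lemma oblique_dir_range i j : rs (w i j).
Proof. exact: range_trB (rowv_range _ _) (range_trZ _ (rowv_range _ _)). Qed.

Lemma oblique_dir_sin2 i j :
  dotv (w i j) (w i j) = grko_M A j * sin2_angle (a i) (a j).
Proof.
rewrite -oblique_dir_row dotvBr dotvZr (dotvC (a j) (a i)) -norm2_sqr.
have := grko_M_neq0 i; have := grko_M_neq0 j; rewrite /grko_M /sin2_angle.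
by move: (norm2 _ ^+ 2) (norm2 _ ^+ 2) => p q p0 q0; field; apply/andP.
Qed.

(** Covers the degenerate step: if w = 0, row j is a multiple of row i, so equation j is already
    solved along with equation i. *)
Lemma oblique_dir_eq0 i j e : w i j = 0 -> dotv (a i) e = 0 -> dotv (a j) e = 0.
Proof. by move/eqP; rewrite subr_eq0 => /eqP-> ie; rewrite dotvZl ie mulr0. Qed.

Lemma oblique_dirii i : w i i = 0.
Proof.
by rewrite /w -norm2_sqr -/(grko_M A i) divff ?grko_M_neq0 // scale1r subrr.
Qed.

Lemma grko_Delta_ge0 : 0 <= grko_Delta A.
Proof. exact: bigmax_ge_id. Qed.

Lemma sin2_le_Delta i j : i != j -> sin2_angle (a i) (a j) <= grko_Delta A.
Proof.
move=> ij; apply: (bigmax_sup i) => //.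
exact: (le_bigmax_cond _ (fun k => sin2_angle (a i) (a k))).
Qed.

Lemma sqr_oblique_dir_le i j :
  dotv (w i j) (w i j) <= grko_M A j * grko_Delta A.
Proof.
(* The maximum Delta skips i = j, but there w = 0. *)
have [<-|ij] := eqVneq i j.
  by rewrite oblique_dirii dotv0r mulr_ge0 ?grko_Delta_ge0 // ltW ?grko_M_gt0.
by rewrite oblique_dir_sin2 ler_wpM2l ?sin2_le_Delta // ltW ?grko_M_gt0.
Qed.

Lemma grko_Delta_le1 : grko_Delta A <= 1.
Proof.
apply: bigmax_le => // i _; apply: bigmax_le => // j _.
by rewrite gerBl divr_ge0 ?sqr_ge0 // mulr_ge0 ?sqr_ge0.
Qed.

Lemma grko_Delta_gt0P : 0 < grko_Delta A ->
  exists i j, [/\ i != j & w i j != 0].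
Proof.
move/bigmax_gtP => [|[i _ /bigmax_gtP[|[j ij s0]]]]; rewrite ?ltxx //.
exists i, j; split=> //.
by rewrite -dotv_gt0 oblique_dir_sin2 mulr_gt0 ?grko_M_gt0.
Qed.

(** Delta vanishes exactly when every w is 0, that is, when all rows are multiples of a single
    one. *)
Lemma grko_Delta_rank : (0 < grko_Delta A) = (1 < \rank A)%N.
Proof.
apply/idP/idP => [/grko_Delta_gt0P[i [j [_ wij]]]|].
  rewrite ltnNge; apply: contra wij => rA.
  have /andP[_ Ai] : (row i A == A)%MS.
    rewrite -(mxrank_leqif_eq (row_sub i A)) eqn_leq mxrankS ?row_sub //=.
    rewrite (leq_trans rA) // lt0n mxrank_eq0 -trmx_eq0; exact: rows_neq0.
  have /sub_rVP[c jc] := submx_trans (row_sub j A) Ai.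
  have aj : a j = c *: a i by rewrite /rowv jc linearZ.
  rewrite /w {1 2}aj dotvZr -norm2_sqr -/(grko_M A i) mulfK ?subrr //.
  exact: grko_M_neq0.
apply: contraTT; rewrite -leNgt => D0; rewrite -leqNgt.
have [->//|rA] := posnP (\rank A).
pose i := Ordinal (leq_trans rA (rank_leq_row A)).
apply: leq_trans (rank_leq_row (row i A)); apply: mxrankS.
apply/row_subP => j; apply/sub_rVP; exists (dotv (a i) (a j) / grko_M A i).
have /eqP : w i j == 0.
  rewrite -dotv_eq0 eq_le dotv_ge0 andbT; apply: le_trans (sqr_oblique_dir_le i j) _.
  by rewrite pmulr_rle0 ?grko_M_gt0.
move/eqP; rewrite subr_eq0 => /eqP aj; apply: trmx_inj.
by rewrite [LHS]aj linearZ.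
Qed.

End Angles.

(** * One step of the method: orthogonality, error identity, mean contraction *)

Section Contraction.
Context {R : realType} (m n : nat) (A : 'M[R]_(m, n)).
Context (rows_neq0 : forall i, rowv A i != 0).
Context (b : 'cV[R]_m) (xt : 'cV[R]_n) (Axt : A *m xt = b).
Implicit Types (x e : 'cV[R]_n) (i j : 'I_m).
Local Notation a := (rowv A).
Local Notation rs := (range_space A^T).
Local Notation w := (oblique_dir A).
Local Notation M := (grko_M A).
Local Notation F := (normF A ^+ 2).
Local Notation lambda := (lambda_min (A^T *m A)).
Local Notation res := (grko_res A b).

Local Lemma resE x i : b i 0 - dotv (a i) x = - dotv (a i) (x - xt).
Proof. by rewrite -Axt -dotv_rowv dotvBr opprB. Qed.

Local Lemma solP x : (A *m x = b) <-> (A *m (x - xt) = 0).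
Proof.
by rewrite mulmxBr Axt; split=> [->|/eqP]; [rewrite subrr|rewrite subr_eq0 => /eqP].
Qed.

Local Lemma sum_sqr_rows e :
  \sum_i dotv (a i) e ^+ 2 = dotv (A *m e) (A *m e).
Proof. by apply: eq_bigr => i _; rewrite dotv_rowv expr2. Qed.

Local Lemma residualE x :
  norm2 (b - A *m x) ^+ 2 = dotv (A *m (x - xt)) (A *m (x - xt)).
Proof. by rewrite norm2_sqr -Axt -mulmxBr -opprB mulmxN dotvNl dotvNr opprK. Qed.

Lemma grko_resE x j :
  res x j 0 = if j \in grko_U A b x then - dotv (a j) (x - xt) else 0.
Proof. by rewrite mxE resE. Qed.

Lemma grko_step_fix x i j : A *m x = b -> grko_step A b x i j = x.
Proof.
move=> /solP Ax; rewrite /grko_step grko_resE dotv_rowv Ax mxE oppr0.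
by rewrite if_same mul0r scale0r addr0.
Qed.

Lemma grko_step_range x i j : rs (x - xt) -> rs (grko_step A b x i j - xt).
Proof.
move=> rx; rewrite /grko_step -/(w i j) addrAC.
by apply: range_trD => //; apply/range_trZ/oblique_dir_range.
Qed.

Lemma grko_first_range x i : rs (x - xt) -> rs (grko_first A b x i - xt).
Proof.
move=> rx; rewrite /grko_first addrAC.
by apply: range_trD => //; apply/range_trZ/rowv_range.
Qed.

Lemma grko_first_orth x i : dotv (a i) (grko_first A b x i - xt) = 0.
Proof.
rewrite /grko_first addrAC dotvDr dotvZr -norm2_sqr -/(M i) divfK ?grko_M_neq0 //.
by rewrite resE subrr.
Qed.

Lemma grko_first_err x i : norm2 (grko_first A b x i - xt) ^+ 2
  = norm2 (x - xt) ^+ 2 - dotv (a i) (x - xt) ^+ 2 / M i.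
Proof.
rewrite /grko_first addrAC resE; move: (x - xt) => e; rewrite !norm2_sqr.
rewrite dotvDl !dotvDr !dotvZl !dotvZr (dotvC e (a i)) -(norm2_sqr (a i)) -/(M i).
by have := grko_M_neq0 rows_neq0 i => Mi; field.
Qed.

Lemma grko_step_orth_prev x i j :
  dotv (a i) (x - xt) = 0 -> dotv (a i) (grko_step A b x i j - xt) = 0.
Proof.
move=> ie; rewrite /grko_step -/(w i j) addrAC dotvDr dotvZr oblique_dir_orth //.
by rewrite mulr0 addr0.
Qed.

(** For j in U the entry of [grko_res] is the true residual, so the move along w cancels it; if w =
    0 the rows are parallel and there is nothing to cancel. *)
Lemma grko_step_orth_new x i j : j \in grko_U A b x ->
  dotv (a i) (x - xt) = 0 -> dotv (a j) (grko_step A b x i j - xt) = 0.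
Proof.
move=> jU ie; rewrite /grko_step -/(w i j) addrAC dotvDr dotvZr.
rewrite oblique_dir_row // grko_resE jU norm2_sqr.
have [w0|w0] := eqVneq (w i j) 0.
  by rewrite (oblique_dir_eq0 w0 ie) oppr0 !mul0r addr0.
by rewrite divfK ?dotv_eq0 // subrr.
Qed.

(** As e is orthogonal to a_i, <w, e> = <a_j, e>; for j in U the step thus subtracts from e its
    projection on w. *)
Lemma grko_step_err x i j : dotv (a i) (x - xt) = 0 ->
  norm2 (grko_step A b x i j - xt) ^+ 2
  = norm2 (x - xt) ^+ 2 - res x j 0 ^+ 2 / norm2 (w i j) ^+ 2.
Proof.
rewrite /grko_step -/(w i j) addrAC grko_resE; move: (x - xt) => e ie.
have : dotv (w i j) e = dotv (a j) e by rewrite dotvBl dotvZl ie mulr0 subr0.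
move: (w i j) => v ve.
rewrite !norm2_sqr dotvDl !dotvDr !dotvZl !dotvZr (dotvC e v) ve.
(* Outside U the step is null; for w = 0 both sides rely on the convention 0^-1 = 0. *)
case: ifP => _; last by rewrite expr0n !mul0r !addr0 subr0.
have [v0|v0] := eqVneq (dotv v v) 0; last by field.
by rewrite v0 invr0 !mulr0 !mul0r !addr0 subr0.
Qed.

Lemma normF_gt0 (i : 'I_m) : 0 < F.
Proof.
rewrite normF_sqr (bigD1 i) //= ltr_wpDr ?(grko_M_gt0 rows_neq0 i) //.
by apply: sumr_ge0 => j _; rewrite sqr_ge0.
Qed.

Local Notation maxratio x :=
  (\big[Num.max/0]_(i < m) (`|b i 0 - dotv (a i) x| ^+ 2 / norm2 (a i) ^+ 2)).

(** Each row obeys r_i^2 <= maxratio |a_i|^2. The predicate Q allows the rows already solved to be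
    dropped. *)
Lemma sum_residual_le x (Q : pred 'I_m) :
  \sum_(i | Q i) dotv (a i) (x - xt) ^+ 2
  <= maxratio x * \sum_(i | Q i) norm2 (a i) ^+ 2.
Proof.
rewrite mulr_sumr; apply: ler_sum => i _.
rewrite -ler_pdivrMr ?(grko_M_gt0 rows_neq0 i) //; apply: (bigmax_sup i) => //.
by rewrite resE normrN real_normK ?num_real.
Qed.

Lemma residual_le_normF x :
  norm2 (b - A *m x) ^+ 2 <= maxratio x * F.
Proof. by rewrite residualE -sum_sqr_rows normF_sqr sum_residual_le. Qed.

Lemma maxratio_ge0 x : 0 <= maxratio x.
Proof. exact: bigmax_ge_id. Qed.

Lemma residual_gt0 x : A *m x <> b -> 0 < norm2 (b - A *m x) ^+ 2.
Proof.
by move=> Ax; rewrite residualE dotv_gt0; apply/eqP => /solP.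
Qed.

(** The threshold is the average of the largest ratio r_i^2 / |a_i|^2 and of the global ratio |r|^2
    / |A|_F^2, the latter never exceeding the former. *)
Lemma grko_epsE x : A *m x <> b ->
  grko_eps A b x * norm2 (b - A *m x) ^+ 2
  = 2^-1 * (maxratio x + norm2 (b - A *m x) ^+ 2 / F).
Proof.
move=> /residual_gt0 /lt0r_neq0 r0; rewrite /grko_eps.
rewrite -mulrA; congr (_ * _); rewrite mulrDl mulrAC mulVf // mul1r.
by rewrite [in RHS]mulrC.
Qed.

(** A row attaining the maximal ratio passes the threshold and has nonzero residual. Hence
    [grko_prob] is a genuine probability away from solutions. *)
Lemma grko_res_neq0 x : A *m x <> b -> res x != 0.
Proof.
move=> Ax; have r0 := residual_gt0 Ax; have rF := residual_le_normF x.
have [i _] : exists i, dotv (a i) (x - xt) != 0.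
  apply: contrapT => h; apply: Ax; apply/solP/matrixP => i j.
  rewrite (ord1 j) -dotv_rowv mxE; apply/eqP/negPn/negP => hi; apply: h.
  by exists i.
have F0 := normF_gt0 i.
have mx0 : 0 < maxratio x by rewrite -(pmulr_lgt0 _ F0); apply: lt_le_trans rF.
have /= [] := @eq_bigmax _ R _ 0 i predT
  (fun i => `|b i 0 - dotv (a i) x| ^+ 2 / norm2 (a i) ^+ 2) isT.
  by move=> k _; rewrite divr_ge0 ?sqr_ge0.
move=> j _ mxE'; have Mj := grko_M_gt0 rows_neq0 j.
have jE : `|b j 0 - dotv (a j) x| ^+ 2 = maxratio x * M j.
  by rewrite mxE' divfK // lt0r_neq0.
apply: contraNneq (lt0r_neq0 mx0) => res0.
have := congr1 (fun v : 'cV[R]_m => v j 0) res0; rewrite !mxE ifT => [rj|].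
  have := jE; rewrite rj normr0 expr0n => /esym/eqP.
  by rewrite mulf_eq0 (gt_eqF Mj) orbF.
rewrite inE jE ler_pM2r // grko_epsE //.
have : norm2 (b - A *m x) ^+ 2 / F <= maxratio x by rewrite ler_pdivrMr.
by lra.
Qed.

Lemma grko_prob_ge0 x j : 0 <= grko_prob A b x j.
Proof. by rewrite divr_ge0 ?sqr_ge0. Qed.

Lemma sum_grko_prob x : A *m x <> b -> \sum_j grko_prob A b x j = 1.
Proof.
move=> /grko_res_neq0 res0; rewrite -mulr_suml norm2_sqr /dotv.
under eq_bigr do rewrite real_normK ?num_real // expr2.
by rewrite divff // -[X in X != 0]/(dotv _ _) dotv_eq0.
Qed.

Lemma grko_prob_neq0 x j : grko_prob A b x j != 0 ->
  [/\ j \in grko_U A b x & dotv (a j) (x - xt) != 0].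
Proof.
rewrite /grko_prob grko_resE; case: ifP => [jU p0|_]; last first.
  by rewrite normr0 expr0n mul0r eqxx.
split=> //; move: p0; apply: contra_neq => ->.
by rewrite oppr0 normr0 expr0n mul0r.
Qed.

(* The index i that was used last (and the one before it) has zero residual,
   so that g may be taken smaller than |A|_F^2. *)
Lemma grko_step_mean_le x i (g : R) :
  rs (x - xt) -> A *m x <> b -> dotv (a i) (x - xt) = 0 ->
  0 <= g -> norm2 (b - A *m x) ^+ 2 <= maxratio x * g ->
  \sum_j grko_prob A b x j * norm2 (grko_step A b x i j - xt) ^+ 2
  <= (1 - 2^-1 * (g^-1 * F + 1) * (lambda / (grko_Delta A * F)))
     * norm2 (x - xt) ^+ 2.
Proof.
move=> rx Ax ie g0 rg; have r0 := residual_gt0 Ax; have F0 := normF_gt0 i.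
set c := 2^-1 * _ * _.
have A0 : A != 0.
  by apply: contraNneq (rows_neq0 i) => ->; rewrite /rowv linear0 trmx0.
have [lam0 lamP] := lambda_min_gram A0.
have eps_ge : 2^-1 * (g^-1 + F^-1) * (lambda * norm2 (x - xt) ^+ 2)
    <= grko_eps A b x * norm2 (b - A *m x) ^+ 2.
  apply: (@le_trans _ _ (2^-1 * (g^-1 + F^-1) * norm2 (b - A *m x) ^+ 2)).
    rewrite ler_wpM2l //.
      by rewrite mulr_ge0 ?invr_ge0 // addr_ge0 ?invr_ge0 // ltW.
    by rewrite residualE norm2_sqr lamP.
  rewrite grko_epsE // -mulrA ler_pM2l ?invr_gt0 // mulrDl [F^-1 * _]mulrC lerD2r.
  (* For g = 0 the inverse is 0 by convention, and the maximal ratio is still nonnegative. *)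
  have [->|g_neq0] := eqVneq g 0; first by rewrite invr0 mul0r maxratio_ge0.
  by rewrite ler_pdivrMl ?lt_def ?g_neq0 // mulrC.
(* Writing 1 as the sum of the probabilities reduces the mean to one inequality for each j. *)
rewrite -[X in (X - c) * _](sum_grko_prob Ax) mulrBl mulr_suml.
under eq_bigr do rewrite grko_step_err // mulrBr.
rewrite sumrB lerD2l lerN2.
rewrite -[leLHS]mul1r -(sum_grko_prob Ax) mulr_suml; apply: ler_sum => j _.
have [->|p0] := eqVneq (grko_prob A b x j) 0; first by rewrite !mul0r.
rewrite ler_wpM2l ?grko_prob_ge0 //.
(* A j of positive probability has nonzero residual, whereas row i has none; so w is nonzero and
   Delta > 0. *)
have [jU je] := grko_prob_neq0 p0; have Mj := grko_M_gt0 rows_neq0 j.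
have w0 : 0 < dotv (w i j) (w i j).
  by rewrite dotv_gt0; apply: contraNneq je => /oblique_dir_eq0 ->.
have wD := sqr_oblique_dir_le rows_neq0 i j.
have D0 : 0 < grko_Delta A by rewrite -(pmulr_rgt0 _ Mj); apply: lt_le_trans wD.
rewrite (norm2_sqr (w i j)) ler_pdivlMr //.
have -> : c * norm2 (x - xt) ^+ 2 =
    (2^-1 * (g^-1 + F^-1) * (lambda * norm2 (x - xt) ^+ 2)) / grko_Delta A.
  rewrite /c; move: (g^-1) (normF A ^+ 2) (lt0r_neq0 F0) (lt0r_neq0 D0).
  by move=> h f f0 d0; field; apply/andP.
have rM : grko_eps A b x * norm2 (b - A *m x) ^+ 2 * M j <= res x j 0 ^+ 2.
  by move: (jU); rewrite inE mxE jU real_normK ?num_real.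
apply: le_trans rM; apply: (@le_trans _ _
  (grko_eps A b x * norm2 (b - A *m x) ^+ 2 / grko_Delta A
     * (M j * grko_Delta A))); last first.
  by rewrite [M j * _]mulrC mulrA divfK ?lt0r_neq0.
apply: ler_pM => //.
- rewrite divr_ge0 ?(ltW D0) // mulr_ge0 //; last first.
    by rewrite mulr_ge0 ?sqr_ge0 // ltW.
  by rewrite mulr_ge0 ?invr_ge0 // addr_ge0 ?invr_ge0 // ltW.
- exact: dotv_ge0.
- by rewrite ler_pM2r ?invr_gt0.
Qed.

Lemma grko_gamma1_ge0 : 0 <= grko_gamma1 A.
Proof. exact: bigmax_ge_id. Qed.

Lemma grko_gamma2_ge0 : 0 <= grko_gamma2 A.
Proof. exact: bigmax_ge_id. Qed.

Lemma grko_zeta1_mean x i :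
  rs (x - xt) -> A *m x <> b -> dotv (a i) (x - xt) = 0 ->
  \sum_j grko_prob A b x j * norm2 (grko_step A b x i j - xt) ^+ 2
  <= grko_zeta A 1 * norm2 (x - xt) ^+ 2.
Proof.
move=> rx Ax ie; apply: grko_step_mean_le => //; first exact: grko_gamma1_ge0.
rewrite residualE -sum_sqr_rows (bigD1 i) //= ie expr0n add0r.
apply: le_trans (sum_residual_le _ _) _; rewrite ler_wpM2l ?maxratio_ge0 //.
exact: (le_bigmax _ (fun i => \sum_(s < m | s != i) norm2 (a s) ^+ 2)).
Qed.

Lemma grko_zeta2_mean x i i' : i != i' ->
  rs (x - xt) -> A *m x <> b ->
  dotv (a i) (x - xt) = 0 -> dotv (a i') (x - xt) = 0 ->
  \sum_j grko_prob A b x j * norm2 (grko_step A b x i j - xt) ^+ 2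
  <= grko_zeta A 2 * norm2 (x - xt) ^+ 2.
Proof.
move=> ii' rx Ax ie ie'; apply: grko_step_mean_le => //.
  exact: grko_gamma2_ge0.
rewrite residualE -sum_sqr_rows (bigD1 i) //= ie expr0n add0r.
rewrite (bigD1 i') 1?eq_sym //= ie' expr0n add0r.
apply: le_trans (sum_residual_le _ _) _; rewrite ler_wpM2l ?maxratio_ge0 //.
apply: (bigmax_sup i) => //.
exact: (le_bigmax_cond _
  (fun j => \sum_(s < m | (s != i) && (s != j)) norm2 (a s) ^+ 2)).
Qed.

(** The mean decrease is the average of <a_i, e>^2 / |a_i|^2, and |a_i|^2 <= |A|_F^2 bounds it below
    by |A e|^2 / (m |A|_F^2). *)
Lemma grko_zeta0_mean x : (0 < m)%N -> rs (x - xt) ->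
  \sum_j m%:R^-1 * norm2 (grko_first A b x j - xt) ^+ 2
  <= grko_zeta A 0 * norm2 (x - xt) ^+ 2.
Proof.
move=> m0 rx; have F0 := normF_gt0 (Ordinal m0).
have A0 : A != 0.
  by apply: contraNneq (rows_neq0 (Ordinal m0)) => ->; rewrite /rowv linear0 trmx0.
have [lam0 lamP] := lambda_min_gram A0.
under eq_bigr do rewrite grko_first_err mulrBr.
rewrite sumrB sumr_const card_ord -mulrnAl -[_ *+ m]mulr_natr mulVf ?pnatr_eq0 -?lt0n //.
rewrite mulrBl lerD2l lerN2 -mulr_sumr invfM.
rewrite [leLHS](_ : _ = m%:R^-1 * (F^-1 * (lambda * norm2 (x - xt) ^+ 2))).
  rewrite ler_pM2l ?invr_gt0 ?ltr0n // ler_pdivrMl // norm2_sqr.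
  apply: le_trans (lamP _ rx) _.
  rewrite -sum_sqr_rows mulr_sumr; apply: ler_sum => i _.
  rewrite mulrCA ler_peMr ?sqr_ge0 // ler_pdivlMr ?grko_M_gt0 // mul1r.
  by rewrite normF_sqr (bigD1 i) //= lerDl; apply: sumr_ge0 => j _; exact: sqr_ge0.
by rewrite -[LHS]mulrA mulrCA -!mulrA; congr (_ * _); rewrite mulrCA.
Qed.

Lemma grko_Delta0_sol x i : grko_Delta A = 0 -> rs (x - xt) ->
  dotv (a i) (x - xt) = 0 -> x = xt.
Proof.
move=> D0 rx ie; apply/eqP; rewrite -subr_eq0; apply/eqP/(range_tr_inj rx).
apply/matrixP => j k; rewrite (ord1 k) -dotv_rowv mxE.
apply: oblique_dir_eq0 ie; apply/eqP; rewrite -dotv_eq0 eq_le dotv_ge0 andbT.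
by apply: le_trans (sqr_oblique_dir_le rows_neq0 i j) _; rewrite D0 mulr0.
Qed.

End Contraction.

(** * Signs and sizes of the contraction factors *)

Section ZetaBounds.
Context {R : realType} (m n : nat) (A : 'M[R]_(m, n)).
Context (rows_neq0 : forall i, rowv A i != 0).
Local Notation a := (rowv A).
Local Notation rs := (range_space A^T).

Lemma grko_mean_ge0 x i :
  0 <= \sum_j grko_prob A 0 x j * norm2 (grko_step A 0 x i j - 0) ^+ 2.
Proof. by apply: sumr_ge0 => j _; rewrite mulr_ge0 ?grko_prob_ge0 ?sqr_ge0. Qed.

Lemma range_tr_not_sol e : rs e -> e != 0 -> A *m e <> 0.
Proof. by move=> re /eqP e0 /(range_tr_inj re). Qed.

(* For the system A x = 0, the mean inequalities bound a nonnegative quantity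
   by zeta_k |x|^2. *)
Lemma grko_zeta1_ge0 : 0 <= grko_zeta A 1.
Proof.
have [D0|D0] := eqVneq (grko_Delta A) 0.
  (* Division by Delta = 0 gives 0, so the factor is 1. *)
  by rewrite /grko_zeta D0 mul0r invr0 !mulr0 subr0.
have [|i [j [_ w0]]] := @grko_Delta_gt0P _ _ _ _ rows_neq0.
  by rewrite lt_def D0 grko_Delta_ge0.
set x := oblique_dir A i j in w0; have rx : rs x by apply: oblique_dir_range.
have x0 : 0 < norm2 (x - 0) ^+ 2 by rewrite subr0 norm2_sqr dotv_gt0.
rewrite -(pmulr_lge0 _ x0); apply: le_trans (grko_mean_ge0 x i) _.
apply: grko_zeta1_mean => //; rewrite ?mulmx0 ?subr0 //.
  exact: range_tr_not_sol.
exact: oblique_dir_orth.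
Qed.

(** Dimension count: the vectors orthogonal to two rows form a space of codimension at most 2, which
    meets a row space of dimension at least 3. *)
Lemma orth_two_rows i j : (2 < \rank A)%N ->
  exists e, [/\ rs e, e != 0, dotv (a i) e = 0 & dotv (a j) e = 0].
Proof.
move=> rA; pose B := col_mx (row i A) (row j A).
have /rowV0Pn[v] : (A :&: kermx B^T)%MS != 0.
  rewrite -mxrank_eq0 -lt0n.
  have := mxrank_sum_cap A (kermx B^T); rewrite mxrank_ker mxrank_tr.
  have := rank_leq_row B; have := rank_leq_col (A + kermx B^T)%MS.
  have := rank_leq_col B; lia.
rewrite sub_capmx => /andP[/submxP[y vE] /sub_kermxP vB] v0.
have [vi vj] : v *m (row i A)^T = 0 /\ v *m (row j A)^T = 0.
  by move: vB; rewrite /B tr_col_mx mul_mx_row -row_mx0 => /eq_row_mx.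
exists v^T; split.
- by exists y^T => //; rewrite vE trmx_mul.
- by rewrite trmx_eq0.
- by rewrite dotvC dotvE trmxK vi mxE.
- by rewrite dotvC dotvE trmxK vj mxE.
Qed.

(** In rank at least 3, a vector of the row space orthogonal to two rows is a test vector for the
    mean bound; in rank below 2, Delta = 0 and the factor is 1. In rank 2, two independent rows
    leave no such vector. *)
Lemma grko_zeta2_ge0 : \rank A <> 2%N -> 0 <= grko_zeta A 2.
Proof.
move=> rA; have [D0|D0] := eqVneq (grko_Delta A) 0.
  by rewrite /grko_zeta D0 mul0r invr0 !mulr0 subr0.
have Dgt0 : 0 < grko_Delta A by rewrite lt_def D0 grko_Delta_ge0.
have [i [j [ij _]]] := grko_Delta_gt0P rows_neq0 Dgt0.
have [|e [re e0 ie je]] := @orth_two_rows i j.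
  by move: Dgt0; rewrite grko_Delta_rank //; lia.
have x0 : 0 < norm2 (e - 0) ^+ 2 by rewrite subr0 norm2_sqr dotv_gt0.
rewrite -(pmulr_lge0 _ x0); apply: le_trans (grko_mean_ge0 e i) _.
apply: (grko_zeta2_mean rows_neq0 _ ij); rewrite ?mulmx0 ?subr0 //.
exact: range_tr_not_sol.
Qed.

Lemma grko_zeta2_lt1 : 0 < grko_Delta A -> grko_zeta A 2 < 1.
Proof.
move=> D0; have [i _] := grko_Delta_gt0P rows_neq0 D0.
have F0 := normF_gt0 rows_neq0 i.
have A0 : A != 0.
  by apply: contraNneq (rows_neq0 i) => ->; rewrite /rowv linear0 trmx0.
have [lam0 _] := lambda_min_gram A0.
rewrite gtrBl mulr_gt0 ?divr_gt0 ?(mulr_gt0 D0) // mulr_gt0 ?invr_gt0 //.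
by rewrite ltr_wpDl // mulr_ge0 ?invr_ge0 ?grko_gamma2_ge0 // ltW.
Qed.

End ZetaBounds.

(** * Expectation of functions with finitely many values *)

Section FiniteValued.
Context {R : realType} d (T : measurableType d) (P : probability T R).
Context (I : finType) (h : T -> I) (F : I -> R).
Context (mh : forall i, measurable [set t | h t = i]).

Lemma fin_valuedE t : F (h t) = \sum_i F i * \1_[set t | h t = i] t.
Proof.
rewrite (bigD1 (h t)) //= big1 => [|i ih]; last first.
  by rewrite indicE memNset ?mulr0 //= => hi; rewrite hi eqxx in ih.
by rewrite indicE mem_set //= mulr1 addr0.
Qed.

Lemma measurable_fin_valued : measurable_fun setT (F \o h).
Proof.
apply: (eq_measurable_fun (fun t => \sum_i F i * \1_[set t | h t = i] t)).
  by move=> t _; rewrite -fin_valuedE.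
apply: measurable_sum => i; apply: measurable_funM; first exact: measurable_cst.
exact: measurable_indic.
Qed.

Lemma expectation_fin_valued : (forall i, 0 <= F i) ->
  ('E_P[F \o h] = (\sum_i F i * fine (P [set t | h t = i]))%:E)%E.
Proof.
move=> F0; rewrite unlock.
under eq_integral do rewrite /= fin_valuedE -sumEFin.
rewrite ge0_integral_sum //; last 2 first.
- move=> i; apply/measurable_EFinP; apply: measurable_funM.
    exact: measurable_cst.
  exact: measurable_indic.
- by move=> i t _; rewrite lee_fin mulr_ge0.
rewrite -sumEFin; apply: eq_bigr => i _.
rewrite (integralZl_indic _ (fun=> [set t | h t = i])) //; last first.
  by move=> Fi; have := F0 i; rewrite leNgt Fi.
by rewrite integral_indic // setIT EFinM fineK ?fin_num_measure.
Qed.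

End FiniteValued.

(** * Summable nonnegative series *)

Section SeriesTerms.
Context {R : realType}.

(** Each term is squeezed between 0 and the tail of the series, which tends to 0. *)
Lemma nneseries_terms_cvg0 (u : nat -> R) : (forall k, 0 <= u k) ->
  (\sum_(0 <= k <oo) (u k)%:E < +oo)%E -> (u k)%:E @[k --> \oo] --> 0%E.
Proof.
move=> u0 su; apply: (squeeze_cvge _ (cvg_cst _) (nneseries_tail_cvg su _)).
  apply: nearW => k /=; rewrite lee_fin u0 /=.
  apply: le_trans (nneseries_lim_ge k.+1 _); first by rewrite big_nat1.
  by move=> i _ _; rewrite lee_fin.
by move=> k _; rewrite lee_fin.
Qed.

Lemma nneseries_contraction (u : nat -> R) q : 0 <= q < 1 ->
  (forall k, 0 <= u k) -> (forall k, u k.+1 <= q * u k) ->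
  (\sum_(0 <= k <oo) (u k)%:E < +oo)%E.
Proof.
move=> /andP[q0 q1] u0 uS.
(* Since (1 - q) u_k <= u_k - u_{k+1}, the partial sums telescope. *)
have part N : \sum_(0 <= k < N) u k <= (u 0%N - u N) / (1 - q).
  elim: N => [|N IH]; first by rewrite big_geq // subrr mul0r.
  rewrite big_nat_recr //= ; move: IH; rewrite !ler_pdivlMr ?subr_gt0 //.
  by have := uS N; lra.
apply: (@le_lt_trans _ _ (u 0%N / (1 - q))%:E); last by rewrite ltry.
apply: lime_le; first by apply: is_cvg_nneseries => k _ _; rewrite lee_fin.
apply: nearW => N; rewrite sumEFin lee_fin; apply: le_trans (part N) _.
by rewrite ler_pM2r ?invr_gt0 ?subr_gt0 // gerBl.
Qed.

End SeriesTerms.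

(** * Projection onto the null space and the least-norm solution *)

Section OrthProj.
Context {R : realType} (m n : nat) (A : 'M[R]_(m, n)).

Lemma orth_proj_nullP x : let p := orth_proj (null_space A) x in
  A *m p = 0 /\ forall y, A *m y = 0 -> dotv (x - p) y = 0.
Proof.
have [AXA _ _ XAs] := mp_inverseP A.
rewrite /orth_proj /=; case: xgetP => [p _ []//|].
(* Witness that the projection exists: x minus its part in the row space. *)
case/(_ (x - mp_inverse A *m (A *m x))); split.
  by rewrite /null_space /= mulmxBr !mulmxA AXA subrr.
move=> y Ay; rewrite opprB addrC subrK mulmxA -XAs dotv_mull trmxK.
by rewrite -mulmxA Ay mulmx0 dotv0r.
Qed.

(** Removing the common projection leaves two vectors orthogonal to the null space, so their
    difference lies in the row space. *)
Lemma orth_proj_null_eq x y :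
  orth_proj (null_space A) x = orth_proj (null_space A) y ->
  range_space A^T (y - x).
Proof.
move=> pE; apply: range_tr_orth => z Az.
have [_ /(_ _ Az) hx] := orth_proj_nullP x.
have [_ /(_ _ Az) hy] := orth_proj_nullP y.
by move: hx hy; rewrite pE !dotvBl => hx hy; lra.
Qed.

(** Any solution is p + z with z in the null space and p in the row space, so Pythagoras applies. *)
Lemma mp_inverse_least_norm b : (exists x, A *m x = b) ->
  is_least_norm_solution A b (mp_inverse A *m b).
Proof.
have [AXA XAX _ XAs] := mp_inverseP A.
move=> [x0 <-]; split; first by rewrite !mulmxA AXA.
move=> y <-; rewrite /norm2 ler_wsqrtr //; set p := _ *m _.
have [z yE] : exists z, y = p + z by exists (y - p); rewrite addrC subrK.
have pz : dotv p z = 0.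
  rewrite /p mulmxA -XAs dotv_mull trmxK -mulmxA.
  have -> : z = y - p by rewrite yE addrAC subrr add0r.
  by rewrite mulmxBr /p !mulmxA AXA subrr mulmx0 dotv0r.
by rewrite yE dotvDl !dotvDr (dotvC z p) pz addr0 add0r lerDl dotv_ge0.
Qed.

Lemma mp_inverse_range b : range_space A^T (mp_inverse A *m b).
Proof.
by have [_ XAX _ _] := mp_inverseP A; apply/range_trP; rewrite !mulmxA XAX.
Qed.

End OrthProj.

(** Passes from the Euclidean norm to the entrywise topology of matrices: each squared entry is at
    most the squared norm. *)
Lemma norm2_cvg {R : realType} n (u : nat -> 'cV[R]_n) (l : 'cV[R]_n) :
  (norm2 (u k - l) ^+ 2)%:E @[k --> \oo] --> 0%E -> u @ \oo --> l.
Proof.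
move=> /fine_cvgP[_] /cvgrPdist_lt h; apply/cvg_ballP => e e0.
near=> k; split=> // i j; rewrite (ord1 j) /ball /=.
have : `|0 - norm2 (u k - l) ^+ 2| < e ^+ 2.
  by near: k; apply: h; rewrite exprn_gt0.
rewrite sub0r normrN ger0_norm ?sqr_ge0 // => lt_e.
rewrite -(ltr_pXn2r (ltn0Sn 1)) ?nnegrE ?(ltW e0) //.
apply: le_lt_trans lt_e; rewrite norm2_sqr /dotv (bigD1 i) //= distrC.
rewrite real_normK ?num_real // !mxE -expr2 lerDl.
by apply: sumr_ge0 => k' _; rewrite -expr2 sqr_ge0.
Unshelve. all: by end_near. Qed.

Lemma cvg_shift2 (V : ptopologicalType) (u : nat -> V) (l : V) :
  u k.+2 @[k --> \oo] --> l -> u k @[k --> \oo] --> l.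
Proof.
by move=> u2; rewrite -(@cvg_shiftS _ u) -(@cvg_shiftS _ (fun k => u k.+1)).
Qed.

(** * The random iterates and their expected squared error *)

Section Process.
Context {R : realType} (m n : nat) (A : 'M[R]_(m, n)) (b : 'cV[R]_m).
Context (x0 : 'cV[R]_n) d (T : measurableType d) (P : probability T R).
Context (idx : nat -> T -> 'I_m).
Context (rows_neq0 : forall i : 'I_m, rowv A i != 0).
Context (sel : grko_selection A b x0 P idx).
Context (xt : 'cV[R]_n) (Axt : A *m xt = b).
Context (rx0 : range_space A^T (x0 - xt)).
Local Notation a := (rowv A).
Local Notation rs := (range_space A^T).
Local Notation X s k := (grko A b x0 s k).
Local Notation sqerr x := (norm2 (x - xt) ^+ 2).

(** The conditioning event of [grko_selection]: it fixes k + 1 indices, exactly those which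
    determine iterate k + 1. *)
Definition past (k : nat) (s : nat -> 'I_m) : set T :=
  [set t | forall l, (l <= k)%N -> idx l t = s l].

Definition err (k : nat) : R := fine ('E_P[fun t => sqerr (X (idx^~ t) k)])%E.

Local Arguments grko : simpl never.

Lemma grko_stepE s k :
  X s k.+2 = grko_step A b (X s k.+1) (s k) (s k.+1).
Proof. by []. Qed.

Lemma grko_ext s s' k : (forall l, (l < k)%N -> s l = s' l) -> X s k = X s' k.
Proof.
elim: k => // -[_ ss'|k IH ss']; first by rewrite /grko ss'.
rewrite !grko_stepE IH => [|l lk]; first by rewrite !ss'.
by apply: ss'; apply: ltnW.
Qed.

Lemma grko_range s k : rs (X s k - xt).
Proof.
elim: k => // -[_|k IH]; first exact: grko_first_range.
exact: grko_step_range.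
Qed.

Lemma grko_fix s k : A *m X s k.+1 = b -> A *m X s k.+2 = b.
Proof. by move=> Ax; rewrite grko_stepE (grko_step_fix Axt). Qed.

Lemma grko_sol s k : A *m X s k = b -> X s k = xt.
Proof.
move=> Ax; apply/eqP; rewrite -subr_eq0; apply/eqP/(range_tr_inj (grko_range s k)).
by rewrite mulmxBr Ax Axt subrr.
Qed.

Lemma measurable_idx k i : measurable [set t | idx k t = i].
Proof. by case: sel. Qed.

Lemma past_recr k s :
  past k.+1 s = past k s `&` [set t | idx k.+1 t = s k.+1].
Proof.
apply/seteqP; split=> t /= => [h|[h hk] l].
  by split=> [l lk|]; apply: h => //; apply: leqW.
by rewrite leq_eqVlt => /predU1P[->//|]; apply: h.
Qed.

Lemma measurable_past k s : measurable (past k s).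
Proof.
elim: k => [|k IH]; last by rewrite past_recr; apply: measurableI (measurable_idx _ _).
suff -> : past 0 s = [set t | idx 0%N t = s 0%N] by apply: measurable_idx.
by apply/seteqP; split=> t /= h; [exact: h|case].
Qed.

(* Only histories of positive probability matter: elsewhere the step may use an
   index outside U_k, and then the new equation need not be solved. *)
Lemma grko_orth s k : P (past k s) != 0%E -> A *m X s k.+1 <> b ->
  dotv (a (s k)) (X s k.+1 - xt) = 0 /\
  forall l, k = l.+1 -> s l != s k /\ dotv (a (s l)) (X s k.+1 - xt) = 0.
Proof.
elim: k => [|k IH] Pk Ax; first by split=> //; apply: grko_first_orth.
have Axk : A *m X s k.+1 <> b by move=> /grko_fix.
have PkE : P (past k.+1 s) =
    (P (past k s) * (grko_prob A b (X s k.+1) (s k.+1))%:E)%E.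
  by rewrite past_recr; case: sel => _ _ /(_ k s (s k.+1) Axk).
have [Pk0 pk0] : P (past k s) != 0%E /\ grko_prob A b (X s k.+1) (s k.+1) != 0.
  by apply/andP; move: Pk; rewrite PkE mule_eq0 negb_or eqe.
have [ek _] := IH Pk0 Axk; have [jU je] := grko_prob_neq0 Axt pk0.
split=> [|l [<-{l}]]; first exact: grko_step_orth_new.
split; last exact: grko_step_orth_prev.
(* The previous row has zero residual while the newly chosen one does not, so the two indices
   differ. *)
by apply: contraNneq je => <-; apply/eqP.
Qed.

(** * Expectations as finite sums over index histories *)

Section Histories.
Context (i0 : 'I_m).

(** The first k + 1 indices as an element of a finite type; [i0] is only the default of [nth], never
    reached by the iterate. *)
Let hist k (t : T) : k.+1.-tuple 'I_m := [tuple idx l t | l < k.+1].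

Let nth_hist k t l : (l <= k)%N -> nth i0 (hist k t) l = idx l t.
Proof. by move=> lk; rewrite -[l]/(nat_of_ord (Ordinal (lk : l < k.+1)%N)) nth_mktuple. Qed.

Let histE k (s : k.+1.-tuple 'I_m) :
  [set t | hist k t = s] = past k (nth i0 s).
Proof.
apply/seteqP; split=> t /= => [<- l lk|h]; first by rewrite nth_hist.
apply/val_inj/(@eq_from_nth _ i0); rewrite !size_tuple // => l lk.
by rewrite nth_hist // h.
Qed.

Let grko_hist k t : X (idx^~ t) k.+1 = X (nth i0 (hist k t)) k.+1.
Proof. by apply: grko_ext => l lk; rewrite nth_hist. Qed.

Let sqerr_histE k : (fun t => sqerr (X (idx^~ t) k.+1)) =
  (fun s : k.+1.-tuple 'I_m => sqerr (X (nth i0 s) k.+1)) \o hist k.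
Proof.
by apply/funext => t; exact: (congr1 (fun x => sqerr x) (grko_hist k t)).
Qed.

Lemma measurable_sqerr k :
  measurable_fun setT (fun t => sqerr (X (idx^~ t) k.+1)).
Proof.
rewrite sqerr_histE; apply: measurable_fin_valued => s.
by rewrite histE; apply: measurable_past.
Qed.

Lemma expectation_grko k :
  ('E_P[fun t => sqerr (X (idx^~ t) k.+1)] =
   (\sum_(s : k.+1.-tuple 'I_m)
      sqerr (X (nth i0 s) k.+1) * fine (P (past k (nth i0 s))))%:E)%E.
Proof.
under eq_bigr do rewrite -histE.
rewrite sqerr_histE expectation_fin_valued // => s; last exact: sqr_ge0.
by rewrite histE; apply: measurable_past.
Qed.

(** Refines the histories by the next index, so that the selection rule can be applied to each
    pair. *)
Lemma expectation_grko_step k :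
  ('E_P[fun t => sqerr (X (idx^~ t) k.+2)] =
   (\sum_(s : k.+1.-tuple 'I_m) \sum_j
      sqerr (grko_step A b (X (nth i0 s) k.+1) (nth i0 s k) j) *
      fine (P (past k (nth i0 s) `&` [set t | idx k.+1 t = j])))%:E)%E.
Proof.
rewrite pair_bigA /=.
pose h t := (hist k t, idx k.+1 t).
have hE s : [set t | h t = s] = past k (nth i0 s.1) `&` [set t | idx k.+1 t = s.2].
  rewrite -histE; apply/seteqP; case: s => s j; split=> t /=.
    by case=> <- <-.
  by rewrite /h => -[-> ->].
under eq_bigr do rewrite -hE.
rewrite -(@expectation_fin_valued _ _ _ _ _ h (fun s =>
  sqerr (grko_step A b (X (nth i0 s.1) k.+1) (nth i0 s.1 k) s.2))); last 2 first.
- by move=> s; rewrite hE; apply: measurableI (measurable_past _ _) (measurable_idx _ _).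
- by move=> s; apply: sqr_ge0.
congr expectation.body; apply/funext => t.
rewrite [RHS]/comp -grko_hist nth_hist //.
Qed.

End Histories.

(** A probability has total mass 1, so T is inhabited and any drawn index is a witness. *)
Lemma index_exists : exists i : 'I_m, True.
Proof.
have [t _] : exists t : T, True.
  apply: contrapT => h; have := @probability_setT _ _ _ P.
  suff -> : [set: T] = set0 by rewrite measure0 => /esym/eqP; rewrite onee_eq0.
  by apply/seteqP; split=> t // _; apply: h; exists t.
by exists (idx 0%N t).
Qed.

Lemma errE k : ('E_P[fun t => sqerr (X (idx^~ t) k)] = (err k)%:E)%E.
Proof.
have [i0 _] := index_exists; rewrite /err; case: k => [|k]; last first.
  by rewrite (expectation_grko i0).
by rewrite (expectation_cst P (sqerr x0)).
Qed.

Lemma err_ge0 k : 0 <= err k.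
Proof. by rewrite -lee_fin -errE; apply: expectation_ge0 => t; apply: sqr_ge0. Qed.

Lemma err1_le : err 1 <= grko_zeta A 0 * sqerr x0.
Proof.
have [i0 _] := index_exists.
have m0 : (0 < m)%N by case: m i0 => [[]|].
apply: le_trans (grko_zeta0_mean rows_neq0 Axt m0 rx0).
rewrite -lee_fin -errE.
rewrite (_ : (fun t => _) = (fun i => sqerr (grko_first A b x0 i)) \o idx 0%N) //.
rewrite expectation_fin_valued; last 2 first.
- exact: measurable_idx.
- by move=> i; apply: sqr_ge0.
rewrite lee_fin; apply: ler_sum => i _; case: sel => _ -> _.
by rewrite mulrC.
Qed.

(** Null histories and solved ones contribute 0 to both sides; for the others the selection rule
    factors the probability of the extended history. *)
Lemma err_step q k :
  (forall s, P (past k s) != 0%E -> A *m X s k.+1 <> b ->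
     \sum_j grko_prob A b (X s k.+1) j * sqerr (grko_step A b (X s k.+1) (s k) j)
     <= q * sqerr (X s k.+1)) ->
  err k.+2 <= q * err k.+1.
Proof.
move=> mean_le; have [i0 _] := index_exists.
rewrite /err (expectation_grko_step i0) (expectation_grko i0) /=.
rewrite mulr_sumr; apply: ler_sum => s0 _; move: (nth i0 s0) => s {s0 i0}.
have [P0|P0] := eqVneq (P (past k s)) 0%E.
  rewrite P0 /= !mulr0 big1 // => j _.
  suff -> : P (past k s `&` [set t | idx k.+1 t = j]) = 0%E by rewrite mulr0.
  apply/eqP; rewrite eq_le measure_ge0 andbT -P0.
  apply: le_measure; rewrite ?inE; [|exact: measurable_past|by move=> t []].
  exact: measurableI (measurable_past _ _) (measurable_idx _ _).
have [Ax|Ax] := pselect (A *m X s k.+1 = b).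
  rewrite big1 => [|j _].
    by rewrite (grko_sol Ax) subrr norm2_sqr dotv0l mul0r mulr0.
  by rewrite (grko_step_fix Axt) // (grko_sol Ax) subrr norm2_sqr dotv0l mul0r.
rewrite mulrA; apply: le_trans (ler_wpM2r _ (mean_le _ P0 Ax)); last first.
  by rewrite fine_ge0 ?measure_ge0.
rewrite mulr_suml; apply: ler_sum => j _.
case: sel => _ _ /(_ k s j Ax) /= ->.
by rewrite fineM ?fin_num_measure //=; [lra|exact: measurable_past].
Qed.

Lemma err2_le : err 2 <= grko_zeta A 1 * err 1.
Proof.
apply: err_step => s Ps Ax; have [ie _] := grko_orth Ps Ax.
by apply: grko_zeta1_mean => //; apply: grko_range.
Qed.

Lemma err3_le k : err k.+3 <= grko_zeta A 2 * err k.+2.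
Proof.
apply: err_step => s Ps Ax; have [ie /(_ k erefl)[ij je]] := grko_orth Ps Ax.
by apply: grko_zeta2_mean je => //; [rewrite eq_sym|apply: grko_range].
Qed.

Lemma err_Delta0 k : grko_Delta A = 0 -> err k.+1 = 0.
Proof.
move=> D0; have [i0 _] := index_exists; rewrite /err (expectation_grko i0) /=.
rewrite big1 // => s0 _; move: (nth i0 s0) => s.
have [->|P0] := eqVneq (P (past k s)) 0%E; first by rewrite mulr0.
suff -> : X s k.+1 = xt by rewrite subrr norm2_sqr dotv0l mul0r.
have [/grko_sol //|/(grko_orth P0)[ie _]] := pselect (A *m X s k.+1 = b).
exact: (grko_Delta0_sol rows_neq0 D0 (grko_range _ _) ie).
Qed.

(** The induction multiplies a bound by the next factor, which has to be nonnegative. This is proved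
    for [grko_zeta A 1], and for the later factors except in rank 2, where it is assumed. *)
Lemma err_le_prod k : (\rank A = 2%N -> (2 < k.+1)%N -> 0 <= grko_zeta A 2) ->
  err k.+1 <= (\prod_(0 <= s < k.+1) grko_zeta A s) * sqerr x0.
Proof.
elim: k => [_|k IH z2]; first by rewrite big_nat1; apply: err1_le.
rewrite big_nat_recr // [Y in Y * _]mulrC -mulrA.
have zk : 0 <= grko_zeta A k.+1.
  case: k z2 {IH} => [_|k z2]; first exact: grko_zeta1_ge0.
  have [/z2|] := eqVneq (\rank A) 2%N; first exact.
  by move/eqP; apply: grko_zeta2_ge0.
apply: (@le_trans _ _ (grko_zeta A k.+1 * err k.+1)).
  by case: k {IH z2 zk} => [|k]; [exact: err2_le|exact: err3_le].
by rewrite ler_wpM2l // IH // => rA k2; apply: z2 => //; apply: leqW.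
Qed.

(** The shift by 2 starts where the fixed factor [grko_zeta A 2] governs every step. *)
Lemma err_summable : (\sum_(0 <= k <oo) (err k.+2)%:E < +oo)%E.
Proof.
have [D0|D0] := eqVneq (grko_Delta A) 0.
  apply: (@nneseries_contraction _ _ 0) => [|k|k]; rewrite ?lexx ?ltr01 //.
    exact: err_ge0.
  by rewrite err_Delta0 // mul0r.
(* No sign is known for the factor in rank 2, hence the maximum with 0. *)
apply: (@nneseries_contraction _ _ (Num.max 0 (grko_zeta A 2))) => [|k|k].
- by rewrite le_max lexx gt_max ltr01 grko_zeta2_lt1 // lt_def D0 grko_Delta_ge0.
- exact: err_ge0.
- apply: le_trans (err3_le k) _; rewrite ler_wpM2r ?err_ge0 //.
  by rewrite le_max lexx orbT.
Qed.

Lemma expectation_cvg0 :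
  ('E_P[fun t => sqerr (X (idx^~ t) k)])%E @[k --> \oo] --> 0%E.
Proof.
under eq_fun do rewrite errE.
have := nneseries_terms_cvg0 (fun k => err_ge0 k.+2) err_summable.
exact: (@cvg_shift2 _ (fun k => (err k)%:E)).
Qed.

(** Exchanging sum and integral, the total squared error has finite expectation; almost surely the
    series is finite and its terms tend to 0. *)
Lemma grko_cvg_ae : {ae P, forall t, (fun k => X (idx^~ t) k) @ \oo --> xt}.
Proof.
pose f k t := (sqerr (X (idx^~ t) k.+2))%:E.
have f0 k t : (0 <= f k t)%E by rewrite lee_fin sqr_ge0.
have mf k : measurable_fun setT (f k).
  by apply/measurable_EFinP; have [i0 _] := index_exists; apply: measurable_sqerr.
have int_err k : (\int[P]_t f k t = (err k.+2)%:E)%E.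
  by rewrite -errE expectation.unlock.
have int_f : P.-integrable setT (fun t => \sum_(0 <= k <oo) f k t)%E.
  apply/integrableP; split; first exact: ge0_emeasurable_sum.
  under eq_integral => t _ do
    rewrite gee0_abs ?(nneseries_ge0 (fun k _ _ => f0 k t)) //.
  rewrite integral_nneseries //.
  under eq_eseriesr do rewrite int_err.
  exact: err_summable.
have := integrable_ae measurableT int_f.
apply: filterS => t /(_ I) ft; apply: norm2_cvg.
have := nneseries_terms_cvg0 (fun k => sqr_ge0 (norm2 (X (idx^~ t) k.+2 - xt))).
rewrite ltey_eq ft => /(_ isT).
exact: (@cvg_shift2 _ (fun k => (sqerr (X (idx^~ t) k))%:E)).
Qed.

End Process.

Theorem theorem1 (R : realType) (m n : nat)
    (A : 'M[R]_(m, n)) (b : 'cV[R]_m) (x0 : 'cV[R]_n)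
    (d : measure_display) (T : measurableType d) (P : probability T R)
    (idx : nat -> T -> 'I_m)
    (rows_neq0 : forall i : 'I_m, rowv A i != 0)
    (consistent : exists x : 'cV[R]_n, A *m x = b)
    (sel : grko_selection A b x0 P idx) :
  let X (k : nat) (t : T) : 'cV[R]_n := grko A b x0 (idx^~ t) k in
  [/\ (1 < \rank A)%N -> 0 < grko_Delta A <= 1,
      forall xt : 'cV[R]_n,
        A *m xt = b ->
        orth_proj (null_space A) xt = orth_proj (null_space A) x0 ->
        forall k : nat, (1 <= k)%N ->
        (\rank A = 2%N -> (2 < k)%N -> 0 <= grko_zeta A 2) ->
        ('E_P[fun t => (norm2 (X k t - xt) ^+ 2)%R]
          <= ((\prod_(0 <= s < k) grko_zeta A s) * norm2 (x0 - xt) ^+ 2)%:E)%E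
    & x0 \in range_space A^T ->
        [/\ is_least_norm_solution A b (mp_inverse A *m b),
            {ae P, forall t, X^~ t @ \oo --> mp_inverse A *m b}
          & ('E_P[fun t => (norm2 (X k t - mp_inverse A *m b) ^+ 2)%R]
              @[k --> \oo] --> 0)%E]].
Proof.
move=> X; split.
- by rewrite -(grko_Delta_rank rows_neq0) => ->; rewrite grko_Delta_le1.
- move=> xt Axt /orth_proj_null_eq rx0 [//|k] _ zeta2_ge0.
  by rewrite /X (errE sel) lee_fin; apply: err_le_prod.
- move=> /set_mem rx; have [AX lnX] := mp_inverse_least_norm consistent.
  (* The pseudoinverse solution lies in the row space, as x0 does, so it can serve as the reference
     solution. *)
  have rx0 := range_trB rx (mp_inverse_range A b).
  split; [by [] | exact: grko_cvg_ae rows_neq0 sel _ AX rx0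
                | exact: expectation_cvg0 rows_neq0 sel _ AX rx0].
Qed.
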